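(* Let $\mathcal B$ be a collared Bratteli diagram associated with a $1$-dimensional tiling, with labelled edges. Then there is a partial order on edges, which induces a partial order on infinite paths. Furthermore, there is a one-to-one map $\psi$ from the set of maximal paths to the set of minimal paths, such that $$R_{\mathcal B}=R_{AF}\ \wedge\ \bigcup_{x\ \text{maximal path}}(x,\psi(x)),$$ i.e. $R_{\mathcal B}$ is generated by $R_{AF}$ and the pairs $(x,\psi(x))$, $x$ a maximal path.
   Context: A collared Bratteli diagram associated with a $1$-dimensional tiling is one associated, as below, with a proper nested sequence $(T_n)_{n\in\mathbb N}$ of tilings of $\mathbb R$ ($d=1$ below). Given the order on edges, an edge $e\in\mathcal E$ is minimal (maximal) if it is so among the edges with the same range, and a minimal (maximal) path is an infinite path made only of minimal (maximal) edges. The induced order on infinite paths compares two distinct paths $(e_n)$, $(e'_n)$ that agree from some generation on by comparing $e_m$ and $e'_m$ for the largest $m$ with $e_m\ne e'_m$. **Tilings.** A tile is a compact subset of $\mathbb R^d$ equal to the closure of its interior; every tile is punctured (comes with a distinguished point of it, its puncture) and may carry a label; equality and translation of tiles respect punctures and labels. A patch is a finite set of tiles with pairwise disjoint interiors, whose union is its support; a tiling is a countable set of tiles with pairwise disjoint interiors and union $\mathbb R^d$. Tiles have finite CW-complex structures, and the intersection of two tiles of a tiling is a subcomplex of both. The inner (outer) radius of a tile or patch is the radius of the largest (smallest) ball centered at its puncture contained in (containing) its support. $T$ has FLC if for each $\rho>0$ there are finitely many patches of $T$ of outer radius $<\rho$ up to translation; it is repetitive if for each patch $p\subset T$ there is $\rho_p>0$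 such that for every $x\in\mathbb R^d$ some translate of $p$ is a set of tiles of $T$ contained in $B(x,\rho_p)$; it is aperiodic if $T+a\ne T$ for all $a\neq0$. **Proper nested sequences.** A nested sequence of tilings is a sequence $(T_n)_{n\ge1}$ of tilings such that for all $n\ge2$ the tiles of $T_n$ are (supports of) patches of $T_{n-1}$; one assumes (without loss of generality) that $T_1$ has a tile with puncture at $0$. The substitution map $\sigma_n$ ($n\ge2$) sends each tile of $T_n$ to the patch of $T_{n-1}$ of which it is the support (tiles of $T_n$ with the same shape but corresponding to different patches are labelled as different); it is extended to translates of tiles by $\sigma_n(t+a)=\sigma_n(t)+a$. Let $r_n>0$ be the minimum of the inner radii and $R_n$ the maximum of the outer radii of the tiles of $T_n$. The sequence is proper if every $T_n$ is aperiodic, repetitive and has FLC, and for all $n\ge2$: (i) for each tile $t_n\in T_n$, $\sigma_n(t_n)$ is a patch of $T_{n-1}$; (ii) for each tile $t_n\in T_n$, $\sigma_n(t_n)$ contains a tile of $T_{n-1}$ in the interior of its support; (iii) there is $\rho>0$ independent of $n$ with $r_n>r_{n-1}+\rho$ and $R_n>R_{n-1}+\rho$. **Collars.** For $t\in T_n$, $\mathrm{Col}(t)=\{t'\in T_n:\mathrm{dist}(t,t')\le r_n\}$. A collared prototile of $T_n$ is a class of tiles of $T_n$ that agree, together with their collars, up to translation. There are finitely many; let $t^{(n)}_i$, $i=1,\dots,p_n$, denote their representatives with puncture at $0$ (a collared tile remembers its collar). **Bratteli diagram $(\mathcal V,\mathcal E,r,s,u)$ of $(T_n)$.** $\mathcal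 V_0=\{\circ\}$, $\mathcal V_n=\{t^{(n)}_i\}_i$ for $n\ge1$; $\mathcal E_1$ has one edge from $\circ$ to each vertex of $\mathcal V_1$, with label $u=0$; for $n\ge2$, $\mathcal E_n$ has one edge $e$ with $s(e)=t^{(n-1)}_i$, $r(e)=t^{(n)}_j$ for each $a\in\mathbb R^d$ such that the collared tile $t^{(n-1)}_i+a$ is a tile of the patch $\sigma_n(t^{(n)}_j)$, and its label is $u(e)=-a$. $\partial\mathcal B$ is the set of infinite paths $(e_n)_{n\ge1}$, $e_n\in\mathcal E_n$, $r(e_n)=s(e_{n+1})$. The AF-relation is $R_{AF}=\{((e_n),(e'_n))\in\partial\mathcal B\times\partial\mathcal B:\exists n_0\ \forall n\ge n_0,\ e_n=e'_n\}$. **Horizontal structure (making the diagram collared).** $\mathcal H=\bigsqcup_n\mathcal H_n$, $r,s:\mathcal H_n\to\mathcal V_n$: there is an edge $h\in\mathcal H_n$ with $s(h)=t$, $r(h)=t'$ and label $u(h)=a'-a$ whenever there are $a,a'\in\mathbb R^d$ such that the collared tiles $t+a$, $t'+a'$ belong to $T_n$, with $t+a\in\mathrm{Col}(t'+a')$ and $t'+a'\in\mathrm{Col}(t+a)$ (one edge for each triple $(t,t',a'-a)$; trivial edges $t=t'$, $u=0$ allowed). **The relation $R_{\mathcal B}$.** For $e,e'\in\mathcal E_n$, $h\in\mathcal H_{n-1}$, $h'\in\mathcal H_n$, one says $(h,e,e',h')$ is a commutative diagram if $s(h)=s(e)$, $r(h)=s(e')$, $r(e)=s(h')$, $r(e')=r(h')$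 and $u(e)+u(h')=u(h)+u(e')$. For $x=(e_n)$, $y=(e'_n)$ in $\partial\mathcal B$, $x\sim y$ means: there are $n_0$ and $h_n\in\mathcal H_n$ for all $n\ge n_0$ such that $(h_{n-1},e_n,e'_n,h_n)$ is a commutative diagram for each $n>n_0$. $R_{\mathcal B}=\{(x,y)\in\partial\mathcal B\times\partial\mathcal B:x\sim y\}$.
   Formalization: Tiles are additionally assumed connected (closed intervals); for tiles that are finite unions of disjoint intervals the claim can fail when the order compares all edges with the same range. *)

(* Defs.v *)
From Stdlib Require Export Relation_Operators.
From mathcomp Require Export all_boot all_order all_algebra.
From mathcomp Require Export all_classical all_reals all_analysis.
Export numFieldNormedType.Exports.
Export Order.TTheory GRing.Theory Num.Theory.
Set Implicit Arguments.
Unset Strict Implicit.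
Unset Printing Implicit Defensive.

Local Open Scope classical_set_scope.
Local Open Scope ring_scope.

(** * Punctured, labelled tiles of the line *)

(* Equality of records compares supports, punctures and labels.  Unlabelled
   tiles are obtained with [L := unit]. *)
Record tile (R : realType) (L : Type) : Type := Tile {
  supp : set R;
  punct : R;
  lab : L }.

Section Tilings.
Variables (R : realType) (L : Type).
Implicit Types (t : tile R L) (P T : set (tile R L)) (A B : set R) (a c : R).

(* [connected]: the tiles of a 1-dimensional tiling are intervals.  A tile is
   then some [[a, b]] with a < b, and the CW-structure with 0-cells a and b is
   finite; two tiles with disjoint interiors meet in a subcomplex of both. *)
Definition is_tile t : Prop :=
  [/\ compact (supp t),
      supp t = closure (interior (supp t)),
      connected (supp t) &
      supp t (punct t)].

Definition tile_trans a t : tile R L :=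
  Tile [set x + a | x in supp t] (punct t + a) (lab t).

Definition trans a P : set (tile R L) := [set tile_trans a t | t in P].

Definition support P : set R := [set x | exists2 t, P t & supp t x].

Definition disjoint_interiors P : Prop :=
  forall t t', P t -> P t' -> t <> t' ->
    interior (supp t) `&` interior (supp t') = set0.

Definition is_patch P : Prop :=
  [/\ finite_set P, (forall t, P t -> is_tile t) & disjoint_interiors P].

Definition patch_of T P : Prop := is_patch P /\ P `<=` T.

Definition is_tiling T : Prop :=
  [/\ countable T, (forall t, T t -> is_tile t), disjoint_interiors T &
      support T = setT].

(* Closed balls are written out because [closed_ball c 0] is empty. *)
Definition inner_radius c A : R :=
  sup [set rho | 0 <= rho /\ [set x | `|x - c| <= rho] `<=` A].

Definition outer_radius c A : R :=
  inf [set rho | 0 <= rho /\ A `<=` [set x | `|x - c| <= rho]].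

Definition dist A B : R := inf [set `|x - y| | x in A & y in B].

(* A patch is punctured at the puncture of one of its tiles. *)
Definition FLC T : Prop :=
  forall rho : R, 0 < rho ->
  exists F : set (set (tile R L)), finite_set F /\
    forall P, patch_of T P ->
      (exists2 t, P t & outer_radius (punct t) (support P) < rho) ->
      exists Q a, F Q /\ P = trans a Q.

Definition repetitive T : Prop :=
  forall P, patch_of T P ->
  exists rho : R, 0 < rho /\
    forall x : R, exists a,
      trans a P `<=` T /\ support (trans a P) `<=` ball x rho.

Definition aperiodic T : Prop := forall a, a <> 0 -> trans a T <> T.

(** * Proper nested sequences

    The tilings T n are indexed by n >= 1 ([T 0] is never used), and
    [sigma n], for n >= 2, is the substitution map from T n to T n.-1. *)

Variables (T : nat -> set (tile R L))
          (sigma : nat -> tile R L -> set (tile R L)).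

(* The last condition extends [sigma] to translates of tiles.  It applies also
   when both t and its translate are tiles of T n.+1, and thus says that tiles
   with the same shape but different patches carry different labels. *)
Definition nested_sequence : Prop :=
  [/\ (forall n, (1 <= n)%N -> is_tiling (T n)),
      (exists2 t, T 1%N t & punct t = 0),
      (forall n t, (1 <= n)%N -> T n.+1 t ->
         patch_of (T n) (sigma n.+1 t) /\ support (sigma n.+1 t) = supp t) &
      (forall n t a, (1 <= n)%N -> T n.+1 t ->
         sigma n.+1 (tile_trans a t) = trans a (sigma n.+1 t))].

(* By FLC the infimum and the supremum are attained. *)
Definition rmin n : R :=
  inf [set inner_radius (punct t) (supp t) | t in T n].

Definition Rmax n : R :=
  sup [set outer_radius (punct t) (supp t) | t in T n].

Definition proper_nested_sequence : Prop :=
  [/\ nested_sequence,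
      (forall n, (1 <= n)%N ->
         [/\ aperiodic (T n), repetitive (T n), FLC (T n) & 0 < rmin n]),
      (forall n t, (1 <= n)%N -> T n.+1 t ->
         exists2 t', sigma n.+1 t t' & supp t' `<=` interior (supp t)) &
      (exists rho : R, 0 < rho /\ forall n, (1 <= n)%N ->
         rmin n + rho < rmin n.+1 /\ Rmax n + rho < Rmax n.+1)].

(** * The collared Bratteli diagram *)

Definition Col n t : set (tile R L) :=
  [set t' | T n t' /\ dist (supp t) (supp t') <= rmin n].

(* A tile together with its collar.  Collared prototiles are represented by
   collared tiles with puncture at 0. *)
Definition ctile : Type := (tile R L * set (tile R L))%type.

Definition cproto n t : ctile :=
  (tile_trans (- punct t) t, trans (- punct t) (Col n t)).

Inductive vertex : Type := root | vtx of nat & ctile.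

Definition V n : set vertex :=
  if n is 0 then [set root] else [set vtx n (cproto n t) | t in T n].

(* An edge is determined by its source, range and label; it is used for both
   vertical and horizontal edges.  The level is recorded in the vertices, so
   edge sets of different levels are disjoint. *)
Record edge : Type := Edge { src : vertex; rng : vertex; ulab : R }.

(* In the third case src e and rng e are the collared prototiles of t' and t,
   and a := punct t' - punct t is the translation vector for which src e + a
   is a tile of sigma (rng e). *)
Definition E n : set edge :=
  match n with
  | 0 => set0
  | 1 => [set e | [/\ src e = root, V 1 (rng e) & ulab e = 0]]
  | (m.+1 as k).+1 => [set e | exists t t',
      [/\ T k.+1 t, sigma k.+1 t t', src e = vtx k (cproto k t'),
          rng e = vtx k.+1 (cproto k.+1 t) &
          ulab e = - (punct t' - punct t)]]
  end.

Definition edges : set edge := [set e | exists n, E n e].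

Definition H n : set edge :=
  if n is 0 then set0 else [set h | exists t t',
    [/\ T n t /\ T n t', Col n t' t /\ Col n t t',
        src h = vtx n (cproto n t), rng h = vtx n (cproto n t') &
        ulab h = punct t' - punct t]].

(* [x n] is the edge of generation n.+1 of the infinite path x. *)
Definition is_path (x : nat -> edge) : Prop :=
  forall n, E n.+1 (x n) /\ rng (x n) = src (x n.+1).

Definition bpath : Type := {x : nat -> edge | is_path x}.

Definition eseq (x : bpath) : nat -> edge := proj1_sig x.

Definition R_AF (x y : bpath) : Prop :=
  exists n0, forall n, (n0 <= n)%N -> eseq x n = eseq y n.

Definition commutative_diagram (h e e' h' : edge) : Prop :=
  [/\ src h = src e, rng h = src e', rng e = src h', rng e' = rng h' &
      ulab e + ulab h' = ulab h + ulab e'].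

(* [eseq x n] lies between the generations n and n.+1. *)
Definition R_B (x y : bpath) : Prop :=
  exists (n0 : nat) (h : nat -> edge), (1 <= n0)%N /\
    forall n, (n0 <= n)%N ->
      H n (h n) /\ commutative_diagram (h n) (eseq x n) (eseq y n) (h n.+1).

(** * Orders *)

Definition partial_order_on (X : Type) (A : set X) (le : X -> X -> Prop) :=
  [/\ (forall x, A x -> le x x),
      (forall x y, A x -> A y -> le x y -> le y x -> x = y) &
      (forall x y z, A x -> A y -> A z -> le x y -> le y z -> le x z)].

(* The order of an ordered Bratteli diagram: two edges are comparable if and
   only if they have the same range. *)
Definition edge_order (le : edge -> edge -> Prop) : Prop :=
  partial_order_on edges le /\
  forall e e', edges e -> edges e' -> (le e e' \/ le e' e) <-> rng e = rng e'.

Definition path_le (le : edge -> edge -> Prop) (x y : bpath) : Prop :=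
  x = y \/
  exists m, [/\ eseq x m <> eseq y m,
                (forall n, (m < n)%N -> eseq x n = eseq y n) &
                le (eseq x m) (eseq y m)].

Definition max_edge (le : edge -> edge -> Prop) (e : edge) : Prop :=
  edges e /\ forall e', edges e' -> rng e' = rng e -> le e e' -> e' = e.

Definition min_edge (le : edge -> edge -> Prop) (e : edge) : Prop :=
  edges e /\ forall e', edges e' -> rng e' = rng e -> le e' e -> e' = e.

Definition max_path (le : edge -> edge -> Prop) : set bpath :=
  [set x | forall n, max_edge le (eseq x n)].

Definition min_path (le : edge -> edge -> Prop) : set bpath :=
  [set x | forall n, min_edge le (eseq x n)].

End Tilings.

(* Main.v *)
(** An infinite path prescribes a nested sequence of collared tiles, one of each
    [T n], and [R_B x y] holds iff at every generation the tiles of [x] and [y]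
    occur together in [T n] with a constant displacement.  Radii grow without
    bound, so a late collar determines everything seen at an early generation,
    which makes this relation transitive.  Since tiles are intervals, a nonzero
    displacement forces the gap between the tiles of [x] and [y], which does not
    grow, to close as soon as it is shorter than a tile; from then on the tiles
    are adjacent, one path follows rightmost subtiles and the other leftmost
    ones.  Conversely the right neighbours of the tiles of a maximal path form
    a minimal path, its image under [psi].  The map [psi] is injective since a
    path cannot be both eventually maximal and eventually minimal: every tile
    has a subtile in its interior. *)
Require Import Defs.
From mathcomp Require Import lra.
Local Open Scope classical_set_scope.
Local Open Scope ring_scope.

(** * Tiles as intervals *)

Section TileGeometry.
Set Implicit Arguments.
Unset Strict Implicit.
Unset Printing Implicit Defensive.
Variables (R : realType) (L : Type).
Implicit Types (t s : tile R L) (P : set (tile R L)) (a b : R).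

Lemma tile_eq t s : supp t = supp s -> punct t = punct s -> lab t = lab s ->
  t = s.
Proof. by case: t s => A p l [A' p' l'] /= -> -> ->. Qed.

Lemma tile_transD a b t :
  tile_trans a (tile_trans b t) = tile_trans (b + a) t.
Proof.
apply: tile_eq => //=; last by rewrite addrA.
apply/seteqP; split=> [x [y [z tz <-] <-]|x [z tz <-]].
  by exists z => //; rewrite addrA.
by exists (z + b); [exists z|rewrite addrA].
Qed.

Lemma tile_trans0 t : tile_trans 0 t = t.
Proof.
apply: tile_eq => //=; last by rewrite addr0.
apply/seteqP; split=> [x [z tz <-]|x tx]; first by rewrite addr0.
by exists x => //; rewrite addr0.
Qed.

Lemma tile_transK a : cancel (@tile_trans R L a) (tile_trans (- a)).
Proof. by move=> t; rewrite tile_transD subrr tile_trans0. Qed.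

Lemma transP a P t : trans a P t <-> P (tile_trans (- a) t).
Proof.
split=> [[s Ps <-]|Pt]; first by rewrite tile_transK.
by exists (tile_trans (- a) t) => //; rewrite tile_transD addNr tile_trans0.
Qed.

Definition lo t : R := inf (supp t).
Definition hi t : R := sup (supp t).

(** Compactness makes the extrema of the support attained, and connectedness fills in everything
    between them. *)
Lemma supp_itv t : is_tile t -> supp t = `[lo t, hi t]%classic.
Proof.
case=> cA _ conA Ap.
have A0 : supp t !=set0 by exists (punct t).
have cid : {within supp t, continuous (@id R)}.
  by apply: continuous_subspaceT => x; exact: cvg_id.
have [a /set_mem Aa aP] := compact_EVT_min A0 cA cid.
have [b /set_mem Ab bP] := compact_EVT_max A0 cA cid.
have AE : supp t = `[a, b]%classic.
  apply/seteqP; split=> x /=.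
    by move=> /mem_set Ax; rewrite in_itv /= (aP _ Ax) bP.
  rewrite in_itv /= => xab.
  by move/connected_intervalP: conA; apply; [exact: Aa|exact: Ab|].
have ab : a <= b by apply: aP; exact: mem_set.
by rewrite /lo /hi AE inf_itvcc ?sup_itvcc.
Qed.

Lemma suppP t x : is_tile t -> supp t x <-> lo t <= x <= hi t.
Proof. by move=> /supp_itv {1}->; rewrite /= in_itv. Qed.

Lemma lo_hi t : is_tile t -> lo t <= hi t.
Proof.
move=> tt; have [_ _ _ /(suppP _ tt)/andP[]] := tt; exact: le_trans.
Qed.

Lemma supp_trans_itv a t : is_tile t ->
  supp (tile_trans a t) = `[lo t + a, hi t + a]%classic.
Proof.
move=> tt; apply/seteqP; split=> [x [y /(suppP _ tt) yt <-]|x] /=;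
  rewrite in_itv /=; first by rewrite !lerD2r.
by move=> xt; exists (x - a); [apply/(suppP _ tt); lra|rewrite subrK].
Qed.

Lemma lo_trans a t : is_tile t -> lo (tile_trans a t) = lo t + a.
Proof.
by move=> tt; rewrite /lo supp_trans_itv// inf_itvcc// lerD2r lo_hi.
Qed.

Lemma hi_trans a t : is_tile t -> hi (tile_trans a t) = hi t + a.
Proof.
by move=> tt; rewrite /hi supp_trans_itv// sup_itvcc// lerD2r lo_hi.
Qed.

Lemma inner_radius_ge0 t : is_tile t -> 0 <= inner_radius (punct t) (supp t).
Proof.
move=> tt; have [_ _ _ tp] := tt; apply: ub_le_sup.
  exists (hi t - punct t) => r [r0 /(_ (punct t + r))]/=.
  rewrite addrAC subrr add0r ger0_norm// => /(_ (lexx _))/(suppP _ tt); lra.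
by split=> //= x /=; rewrite normr_le0 subr_eq0 => /eqP ->.
Qed.

Lemma inner_radius_le t : is_tile t ->
  inner_radius (punct t) (supp t) <= punct t - lo t /\
  inner_radius (punct t) (supp t) <= hi t - punct t.
Proof.
move=> tt; have [_ _ _ tp] := tt.
have E0 : [set r | 0 <= r /\ [set x | `|x - punct t| <= r] `<=` supp t] !=set0.
  by exists 0; split=> //= x /=; rewrite normr_le0 subr_eq0 => /eqP ->.
split; apply: ge_sup => // r [r0 H].
  have /(suppP _ tt) : supp t (punct t - r).
    by apply: H; rewrite /= addrAC subrr add0r normrN ger0_norm.
  lra.
have /(suppP _ tt) : supp t (punct t + r).
  by apply: H; rewrite /= addrAC subrr add0r ger0_norm.
lra.
Qed.

(** Intervals that meet are at distance 0, which is where [0 <= r] enters; disjoint ones realize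
    their distance at the two facing endpoints. *)
Lemma dist_leP t s r : is_tile t -> is_tile s -> 0 <= r ->
  dist (supp t) (supp s) <= r <-> lo s - hi t <= r /\ lo t - hi s <= r.
Proof.
move=> tt ts r0; set D := [set `|x - y| | x in supp t & y in supp s].
have lbD : has_lbound D by exists 0 => _ [x _ [y _ <-]].
have [ltt lts] := (lo_hi tt, lo_hi ts).
have memD x y : lo t <= x <= hi t -> lo s <= y <= hi s -> D `|x - y|.
  by move=> xt ys; exists x; [exact/suppP|exists y => //; exact/suppP].
have D0 : D !=set0.
  by exists `|lo t - lo s|; apply: memD; lra.
split=> [tsr|[H1 H2]].
  split; apply: le_trans tsr; apply: lb_le_inf => // _
    [x /(suppP _ tt) xt [y /(suppP _ ts) ys <-]].
    by rewrite distrC; apply: le_trans (ler_norm _); lra.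
  by apply: le_trans (ler_norm _); lra.
have [h1|h1] := leP (lo s) (hi t); have [h2|h2] := leP (lo t) (hi s).
- apply: le_trans r0; apply: ge_inf => //.
  have [h3|h3] := leP (lo s) (lo t).
    by rewrite -(normr0 R) -(subrr (lo t)); apply: memD; lra.
  by rewrite -(normr0 R) -(subrr (lo s)); apply: memD; lra.
- apply: le_trans (ge_inf lbD (memD (lo t) (hi s) _ _)) _; try lra.
  by rewrite gtr0_norm; lra.
- apply: le_trans (ge_inf lbD (memD (hi t) (lo s) _ _)) _; try lra.
  by rewrite ltr0_norm; lra.
- lra.
Qed.

Lemma interiors_meet t s : is_tile t -> is_tile s ->
  lo t < hi t -> lo s < hi s -> lo t < hi s -> lo s < hi t ->
  interior (supp t) `&` interior (supp s) <> set0.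
Proof.
move=> tt ts h1 h2 h3 h4; rewrite (supp_itv tt) (supp_itv ts) !interior_itv.
(* The witness is the midpoint of the intersection of the two intervals. *)
apply/eqP/set0P; exists ((Num.max (lo t) (lo s) + Num.min (hi t) (hi s)) / 2).
by split=> /=; rewrite in_itv /=; case: (leP (lo t) (lo s));
  case: (leP (hi t) (hi s)) => *; lra.
Qed.

(** Undoing the recentering of both sides shows that one translation carries the tile and its
    collar. *)
Lemma cproto_eq (T : nat -> set (tile R L)) n t s :
  cproto T n t = cproto T n s ->
  s = tile_trans (punct s - punct t) t /\
  forall u, Col T n s u <-> Col T n t (tile_trans (punct t - punct s) u).
Proof.
move=> ts; have := congr1 fst ts; have := congr1 snd ts => /= Ec E; split.
  move/(congr1 (tile_trans (punct s))): E.
  by rewrite !tile_transD addNr tile_trans0 addrC => ->.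
move=> u; have E1 v : trans (- punct t) (Col T n t) v <->
  trans (- punct s) (Col T n s) v by rewrite Ec.
have := E1 (tile_trans (- punct s) u).
rewrite !transP !tile_transD !opprK addNr tile_trans0 [_ + punct t]addrC => E2.
by symmetry.
Qed.

End TileGeometry.

(** * Tiles and collars in a proper nested sequence *)

Section NestedSequence.
Set Implicit Arguments.
Unset Strict Implicit.
Unset Printing Implicit Defensive.
Variables (R : realType) (L : Type).
Variables (T : nat -> set (tile R L)) (sigma : nat -> tile R L -> set (tile R L)).
Hypothesis HT : proper_nested_sequence T sigma.
Implicit Types (n m : nat) (t s u w : tile R L) (a : R).

Let r n : R := rmin T n.

Lemma tiling n : (1 <= n)%N -> is_tiling (T n).
Proof. by case: HT => -[H _ _ _] _ _ _ /H. Qed.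

Lemma tiling_tile n t : (1 <= n)%N -> T n t -> is_tile t.
Proof. by move=> /tiling[_ + _ _] => /[apply]. Qed.

Lemma rmin_gt0 n : (1 <= n)%N -> 0 < r n.
Proof. by case: HT => _ H _ _ /H[]. Qed.

(** The inner ball of the tile has radius at least [r n]. In particular every tile of [T n] has
    length at least [2 * r n]. *)
Lemma punct_bounds n t : (1 <= n)%N -> T n t ->
  lo t + r n <= punct t /\ punct t <= hi t - r n.
Proof.
move=> n1 Tt; have tt := tiling_tile n1 Tt.
have rt : r n <= inner_radius (punct t) (supp t).
  apply: ge_inf; last by exists t.
  exists 0 => _ [s Ts <-]; exact/inner_radius_ge0/(tiling_tile n1 Ts).
have [] := inner_radius_le tt; lra.
Qed.

Lemma punct_bounds_lt n t : (1 <= n)%N -> T n t ->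
  lo t < punct t /\ punct t < hi t.
Proof. by move=> n1 Tt; have := rmin_gt0 n1; have := punct_bounds n1 Tt; lra. Qed.

Lemma overlap_eq n t s : (1 <= n)%N -> T n t -> T n s ->
  lo t < hi s -> lo s < hi t -> t = s.
Proof.
move=> n1 Tt Ts ts st; apply: contrapT => neq.
have [_ _ /(_ _ _ Tt Ts neq) + _] := tiling n1.
apply: interiors_meet => //; try exact: tiling_tile n1 _.
  by have := punct_bounds_lt n1 Tt; lra.
by have := punct_bounds_lt n1 Ts; lra.
Qed.

Lemma contains_punct_eq n t s : (1 <= n)%N -> T n t -> T n s ->
  lo s <= punct t <= hi s -> t = s.
Proof.
move=> n1 Tt Ts ps; have := punct_bounds_lt n1 Tt => pt.
by apply: overlap_eq n1 Tt Ts _ _; lra.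
Qed.

Lemma punct_inj n t s : (1 <= n)%N -> T n t -> T n s ->
  punct t = punct s -> t = s.
Proof.
move=> n1 Tt Ts ts; have := punct_bounds_lt n1 Ts => ps.
by apply: contains_punct_eq n1 Tt Ts _; rewrite ts; lra.
Qed.

Lemma lo_inj n t s : (1 <= n)%N -> T n t -> T n s -> lo t = lo s -> t = s.
Proof.
move=> n1 Tt Ts ts; have := punct_bounds_lt n1 Ts; have := punct_bounds_lt n1 Tt.
by move=> h1 h2; apply: overlap_eq n1 Tt Ts _ _; lra.
Qed.

Lemma tile_lt n t s : (1 <= n)%N -> T n t -> T n s ->
  punct t < punct s -> hi t <= lo s.
Proof.
move=> n1 Tt Ts ts; rewrite leNgt; apply/negP => st.
have := punct_bounds_lt n1 Ts; have := punct_bounds_lt n1 Tt => h1 h2.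
have E : t = s by apply: overlap_eq n1 Tt Ts _ _; lra.
by move: ts; rewrite E ltxx.
Qed.

Lemma tiling_cover n x : (1 <= n)%N -> exists2 t, T n t & lo t <= x <= hi t.
Proof.
move=> n1; have [_ _ _ sT] := tiling n1.
have [t Tt tx] : support (T n) x by rewrite sT.
by exists t => //; apply/(suppP _ (tiling_tile n1 Tt)).
Qed.

Lemma right_neighbour n t : (1 <= n)%N -> T n t ->
  exists2 s, T n s & lo s = hi t.
Proof.
move=> n1 Tt; have r0 := rmin_gt0 n1.
(* The offset [r n] is at most half the length of any tile. A gap between [t] and [s] would thus be
   too short for the tile [w] covering its middle, which would have to overlap [t] or [s]. *)
have [s Ts xs] := tiling_cover (hi t + r n) n1.
have pt := punct_bounds n1 Tt; have ps := punct_bounds n1 Ts.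
have ts : hi t <= lo s.
  rewrite leNgt; apply/negP => st.
  have E : t = s by apply: overlap_eq n1 Tt Ts _ _; lra.
  by move: xs; rewrite -E; lra.
exists s => //; apply/eqP; rewrite eq_le ts andbT leNgt; apply/negP => gap.
have [w Tw xw] := tiling_cover ((hi t + lo s) / 2) n1.
have pw := punct_bounds n1 Tw.
have [wt|wt] := leP (hi w) (lo s); last first.
  have E : w = s by apply: overlap_eq n1 Tw Ts _ _; lra.
  by move: xw; rewrite E; lra.
have E : w = t by apply: overlap_eq n1 Tw Tt _ _; lra.
by move: xw; rewrite E; lra.
Qed.

(** * Subtiles, supertiles and the growth of radii *)

Lemma sigma_patch n t : (1 <= n)%N -> T n.+1 t ->
  patch_of (T n) (sigma n.+1 t) /\ support (sigma n.+1 t) = supp t.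
Proof. by case: HT => -[_ _ H _] _ _ _; exact: H. Qed.

Lemma sigma_trans n t a : (1 <= n)%N -> T n.+1 t ->
  sigma n.+1 (tile_trans a t) = trans a (sigma n.+1 t).
Proof. by case: HT => -[_ _ _ H] _ _ _; exact: H. Qed.

Lemma sigma_sub n t s : (1 <= n)%N -> T n.+1 t -> sigma n.+1 t s ->
  [/\ T n s, lo t <= lo s & hi s <= hi t].
Proof.
move=> n1 Tt ts; have [[_ Psub] Psupp] := sigma_patch n1 Tt.
have Ts := Psub _ ts; have st := tiling_tile n1 Ts.
have sub x : supp s x -> supp t x by rewrite -Psupp; exists s.
have tt : is_tile t by exact: tiling_tile Tt.
have /(suppP _ tt)/andP[h1 _] : supp t (lo s).
  by apply: sub; apply/(suppP _ st); rewrite lexx lo_hi.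
have /(suppP _ tt)/andP[_ h2] : supp t (hi s).
  by apply: sub; apply/(suppP _ st); rewrite lexx lo_hi.
by [].
Qed.

Lemma sigma_cover n t x : (1 <= n)%N -> T n.+1 t -> lo t <= x <= hi t ->
  exists2 s, sigma n.+1 t s & lo s <= x <= hi s.
Proof.
move=> n1 Tt xt; have [[_ Psub] Psupp] := sigma_patch n1 Tt.
have tt : is_tile t by exact: tiling_tile Tt.
have [s ts sx] : support (sigma n.+1 t) x by rewrite Psupp; exact/suppP.
by exists s => //; apply/(suppP _ (tiling_tile n1 (Psub _ ts))).
Qed.

Lemma sigma_lo n t : (1 <= n)%N -> T n.+1 t ->
  exists2 s, sigma n.+1 t s & lo s = lo t.
Proof.
move=> n1 Tt; have [|s ts xs] := @sigma_cover n t (lo t) n1 Tt.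
  by rewrite lexx lo_hi//; exact: tiling_tile Tt.
by exists s => //; have [] := sigma_sub n1 Tt ts; lra.
Qed.

Lemma sigma_hi n t : (1 <= n)%N -> T n.+1 t ->
  exists2 s, sigma n.+1 t s & hi s = hi t.
Proof.
move=> n1 Tt; have [|s ts xs] := @sigma_cover n t (hi t) n1 Tt.
  by rewrite lexx lo_hi//; exact: tiling_tile Tt.
by exists s => //; have [] := sigma_sub n1 Tt ts; lra.
Qed.

(** Some tile of the patch covers the puncture of [s]; since punctures are interior, that tile is
    [s]. *)
Lemma sigma_mem n t s : (1 <= n)%N -> T n.+1 t -> T n s ->
  lo t <= punct s <= hi t -> sigma n.+1 t s.
Proof.
move=> n1 Tt Ts st; have [w tw xw] := sigma_cover n1 Tt st.
have [Tw _ _] := sigma_sub n1 Tt tw.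
by rewrite (contains_punct_eq n1 Ts Tw).
Qed.

Lemma supertile n s : (1 <= n)%N -> T n s -> exists2 t, T n.+1 t & sigma n.+1 t s.
Proof.
move=> n1 Ts; have [t Tt xt] := @tiling_cover n.+1 (punct s) isT.
by exists t => //; exact: sigma_mem xt.
Qed.

Lemma sigma_inner n t : (1 <= n)%N -> T n.+1 t ->
  exists2 s, sigma n.+1 t s & hi s < hi t.
Proof.
move=> n1 Tt; have [_ _ /(_ _ _ n1 Tt)[s ts sub] _] := HT.
exists s => //; have [Ts _ _] := sigma_sub n1 Tt ts.
have st := tiling_tile n1 Ts; have /sub : supp s (hi s).
  by apply/suppP => //; rewrite lexx lo_hi.
rewrite supp_itv ?interior_itv/=; last exact: tiling_tile Tt.
by rewrite in_itv /= => /andP[].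
Qed.

Lemma rmin_le n m : (1 <= n <= m)%N -> r n <= r m.
Proof.
case/andP=> n1; elim: m => [|m IH]; first by rewrite leqn0 => /eqP ->.
rewrite leq_eqVlt => /predU1P[->//|]; rewrite ltnS => /[dup] nm /IH.
have [_ _ _ [rho [rho0 /(_ m (leq_trans n1 nm))[+ _]]]] := HT.
rewrite -/(r m) -/(r m.+1); lra.
Qed.

(** Each generation increases the radius by more than the fixed [rho], so the Archimedean property
    applies. *)
Lemma rmin_large n (K : R) : exists2 m, (n <= m)%N & K <= r m.
Proof.
have [_ _ _ [rho [rho0 H]]] := HT.
have rk k : k%:R * rho <= r (n + k).+1.
  elim: k => [|k IH]; first by rewrite mul0r ltW// rmin_gt0.
  have [+ _] := H (n + k).+1 isT.
  rewrite -/(r (n + k).+1) -/(r (n + k).+2) addnS -natr1 mulrDl mul1r; lra.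
exists (n + (Num.truncn (K / rho)).+1).+1; first by rewrite -addnS leq_addr.
apply: le_trans (rk _); rewrite -ler_pdivrMr//; exact/ltW/Num.Theory.truncnS_gt.
Qed.

(** [S] is the iterated supertile of [s]. Since [sigma] commutes with translations, a translate of
    [S] occurring in [T m] brings the same translate of [s] with it. *)
Lemma ancestor n m s : (1 <= n <= m)%N -> T n s -> exists S,
  [/\ T m S, lo S <= lo s, hi s <= hi S &
      forall a, T m (tile_trans a S) -> T n (tile_trans a s)].
Proof.
case/andP=> n1; elim: m => [|m IH].
  by rewrite leqn0 => /eqP n0; rewrite n0 in n1.
rewrite leq_eqVlt => /predU1P[<- Ts|]; first by exists s.
rewrite ltnS => nm Ts; have m1 := leq_trans n1 nm.
have [S [TS lS hS HS]] := IH nm Ts.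
have [S1 TS1 S1S] := supertile m1 TS; exists S1.
have [_ lS1 hS1] := sigma_sub m1 TS1 S1S.
split; [by []|lra|lra|move=> a TaS1; apply: HS].
suff aS : sigma m.+1 (tile_trans a S1) (tile_trans a S).
  by have [] := sigma_sub m1 TaS1 aS.
by rewrite sigma_trans//; exists S.
Qed.

(** * What a collar determines about earlier generations *)

Lemma ColP n t s : (1 <= n)%N -> T n t ->
  Col T n t s <-> [/\ T n s, lo s - hi t <= r n & lo t - hi s <= r n].
Proof.
move=> n1 Tt; have r0 := ltW (rmin_gt0 n1).
split=> [[Ts /dist_leP[]]|[Ts h1 h2]]; try exact: tiling_tile n1 _.
- exact: r0.
- by [].
- by split=> //; apply/dist_leP => //; exact: tiling_tile n1 _.
Qed.

(* Whatever [T n] shows within distance [r m] of a tile of [T m] is determined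
   by the collared tile, because it lies in supertiles of the collar. *)
Lemma near_tile_trans n m t1 t2 s : (1 <= n <= m)%N -> T m t1 -> T m t2 ->
  cproto T m t1 = cproto T m t2 -> T n s ->
  lo s - hi t1 <= r m -> lo t1 - hi s <= r m ->
  T n (tile_trans (punct t2 - punct t1) s).
Proof.
move=> nm Tt1 Tt2 E Ts h1 h2; have [S [TS lS hS HS]] := ancestor nm Ts.
have m1 : (1 <= m)%N by case/andP: nm => /leq_trans; exact.
apply: HS; have [_ C] := cproto_eq E.
have [] // : Col T m t2 (tile_trans (punct t2 - punct t1) S).
apply/C; rewrite tile_transD subrKA subrr tile_trans0.
by apply/ColP => //; split => //; lra.
Qed.

(** The margin [r n] in the bounds on [s] keeps its whole collar within distance [r m] of [t1]. *)
Lemma near_Col_trans n m t1 t2 s w : (1 <= n <= m)%N -> T m t1 -> T m t2 ->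
  cproto T m t1 = cproto T m t2 -> T n s ->
  hi s + r n <= hi t1 + r m -> lo t1 - r m <= lo s - r n ->
  Col T n s w -> Col T n (tile_trans (punct t2 - punct t1) s)
    (tile_trans (punct t2 - punct t1) w).
Proof.
move=> nm Tt1 Tt2 E Ts h1 h2; have n1 : (1 <= n)%N by case/andP: nm.
have r0 := rmin_gt0 n1; have st := tiling_tile n1 Ts.
have ls := lo_hi st; case/(ColP _ n1 Ts) => Tw d1 d2.
have wt := tiling_tile n1 Tw.
have lw := lo_hi wt; apply/ColP => //.
  by apply: near_tile_trans nm Tt1 Tt2 E Ts _ _; lra.
split; [by apply: near_tile_trans nm Tt1 Tt2 E Tw _ _; lra| |];
  rewrite lo_trans// hi_trans//; lra.
Qed.

(** Translation carries the collar of [s] into that of its image; the reverse inclusion is the same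
    fact with [t1] and [t2] exchanged. *)
Lemma near_cproto n m t1 t2 s : (1 <= n <= m)%N -> T m t1 -> T m t2 ->
  cproto T m t1 = cproto T m t2 -> T n s ->
  hi s + r n <= hi t1 + r m -> lo t1 - r m <= lo s - r n ->
  T n (tile_trans (punct t2 - punct t1) s) /\
  cproto T n (tile_trans (punct t2 - punct t1) s) = cproto T n s.
Proof.
move=> nm Tt1 Tt2 E Ts h1 h2; have n1 : (1 <= n)%N by case/andP: nm.
have m1 : (1 <= m)%N by case/andP: nm => /leq_trans; exact.
have r0 := rmin_gt0 n1; have st := tiling_tile n1 Ts.
have t1t := tiling_tile m1 Tt1; have ls := lo_hi st.
have Tas : T n (tile_trans (punct t2 - punct t1) s).
  by apply: near_tile_trans nm Tt1 Tt2 E Ts _ _; lra.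
have [E2 _] := cproto_eq E.
split=> //; set a := punct t2 - punct t1.
have back : punct t1 - punct t2 = - a by rewrite opprB.
rewrite /cproto; congr pair => /=.
  by rewrite tile_transD opprD addrCA subrr addr0.
apply/seteqP; split=> u /transP; rewrite opprK => uC; apply/transP; rewrite opprK.
  have := @near_Col_trans n m t2 t1 _ _ nm Tt2 Tt1 (esym E) Tas _ _ uC.
  rewrite back -/a !tile_transD subrr tile_trans0 /= addrK; apply.
    by rewrite hi_trans// E2 hi_trans// -/a; lra.
  by rewrite lo_trans// E2 lo_trans// -/a; lra.
have := near_Col_trans nm Tt1 Tt2 E Ts h1 h2 uC.
by rewrite tile_transD.
Qed.

(** * The order on edges *)

Lemma cproto_lo n t s : (1 <= n)%N -> T n t -> T n s ->
  cproto T n t = cproto T n s -> lo t - punct t = lo s - punct s.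
Proof.
move=> n1 Tt Ts /cproto_eq[-> _]; rewrite lo_trans/=; first by lra.
exact: tiling_tile Tt.
Qed.

Lemma cproto_hi n t s : (1 <= n)%N -> T n t -> T n s ->
  cproto T n t = cproto T n s -> hi t - punct t = hi s - punct s.
Proof.
move=> n1 Tt Ts /cproto_eq[-> _]; rewrite hi_trans/=; first by lra.
exact: tiling_tile Tt.
Qed.

Lemma vtx_inj n m (c c' : ctile R L) : vtx n c = vtx m c' -> c = c'.
Proof. by case. Qed.

Lemma edge_ext (e e' : edge R L) : src e = src e' -> rng e = rng e' ->
  ulab e = ulab e' -> e = e'.
Proof. by case: e e' => s v l [s' v' l'] /= -> -> ->. Qed.

Definition edge_of n t s : edge R L :=
  Edge (vtx n (cproto T n s)) (vtx n.+1 (cproto T n.+1 t)) (punct t - punct s).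

Lemma EP n e : (1 <= n)%N ->
  E T sigma n.+1 e <->
  exists t s, [/\ T n.+1 t, sigma n.+1 t s & e = edge_of n t s].
Proof.
case: n => // n _; split=> -[t [s]].
  case=> Tt ts e1 e2 e3; exists t, s; split => //.
  by apply: edge_ext => //; rewrite e3 opprB.
by case=> Tt ts ->; exists t, s; split => //=; rewrite opprB.
Qed.

Lemma E_rng n e : E T sigma n e ->
  [/\ (1 <= n)%N & exists2 t, T n t & rng e = vtx n (cproto T n t)].
Proof.
case: n => [//|[[_ [t Tt te] _]|n]].
  by split=> //; exists t.
by case/EP => // t [s [Tt ts ->]]; split=> //; exists t.
Qed.

Lemma edges_rng n (c : ctile R L) e :
  edges T sigma e -> rng e = vtx n c -> E T sigma n e.
Proof. by case=> m /[dup] me /E_rng[_ [t _ ->]] [<- _]. Qed.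

(** An edge comes from some tile with the given collared prototile, not necessarily [t]. As
    [r n <= r n.+1], the collar of that tile determines the collars of its subtiles, so the subtile
    moves into [t] with its collar. *)
Lemma edge_at n t e : (1 <= n)%N -> T n.+1 t -> edges T sigma e ->
  rng e = vtx n.+1 (cproto T n.+1 t) ->
  exists2 s, sigma n.+1 t s & e = edge_of n t s.
Proof.
move=> n1 Tt eE et; have := edges_rng eE et; move: et => /[swap].
case/(EP _ n1) => t0 [s0 [Tt0 t0s0 ->]] /vtx_inj Ec.
have [Ts0 h1 h2] := sigma_sub n1 Tt0 t0s0.
have nm : (1 <= n <= n.+1)%N by rewrite n1 leqnSn.
have rr := rmin_le nm.
have [||Ts Es] := near_cproto nm Tt0 Tt Ec Ts0.
- by rewrite lerD.
- by rewrite lerB.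
exists (tile_trans (punct t - punct t0) s0).
  have [Et _] := cproto_eq Ec.
  by rewrite [X in sigma _ X]Et sigma_trans//; exists s0.
by apply: edge_ext => //=; [rewrite Es|rewrite Ec|lra].
Qed.

Lemma edge_of_in n t s : (1 <= n)%N -> T n.+1 t -> sigma n.+1 t s ->
  edges T sigma (edge_of n t s).
Proof. by move=> n1 Tt ts; exists n.+1; apply/EP => //; exists t, s. Qed.

(** Inside a fixed range tile the label locates the puncture of the subtile, hence the subtile; in
    generation 1 there is only one edge per range. This gives antisymmetry of the order. *)
Lemma edge_eq e e' : edges T sigma e -> edges T sigma e' ->
  rng e = rng e' -> ulab e = ulab e' -> e = e'.
Proof.
move=> [n /[dup] ne /E_rng[n1 [t Tt et]]] e'E ee' uu.
have := edges_rng e'E (etrans (esym ee') et).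
case: n => [//|[|n]] in ne n1 Tt et * => e'n.
  by case: ne e'n => s1 _ _ [s1' _ _]; apply: edge_ext => //; rewrite s1.
have eE : edges T sigma e by exists n.+2.
have [s ts es] := edge_at (ltn0Sn n) Tt eE et.
have [|s' ts' es'] := edge_at (ltn0Sn n) Tt e'E; first by rewrite -ee'.
have [Ts _ _] := sigma_sub (ltn0Sn n) Tt ts.
have [Ts' _ _] := sigma_sub (ltn0Sn n) Tt ts'.
rewrite es es' (@punct_inj n.+1 s s')//.
by move: uu; rewrite es es' /= => /addrI/oppr_inj.
Qed.

(* The label [punct t - punct s] of an edge decreases from left to right. *)
Definition edge_le (e e' : edge R L) : Prop :=
  rng e = rng e' /\ ulab e' <= ulab e.

Lemma edge_leP : edge_order T sigma edge_le.
Proof.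
split; first split.
- by [].
- by move=> e e' eE e'E [ee' h1] [_ h2]; apply: edge_eq => //; apply: le_anti;
    rewrite h1 h2.
- move=> e e' e'' _ _ _ [h h1] [h' h2].
  by split; [exact: etrans h h'|exact: le_trans h2 h1].
- move=> e e' _ _; split=> [[[]|[]]//|ee'].
  by case: (leP (ulab e) (ulab e')) => h; [right|left]; split => //; exact: ltW.
Qed.

Lemma edge_le_of n t s s' :
  edge_le (edge_of n t s) (edge_of n t s') <-> punct s <= punct s'.
Proof. by rewrite /edge_le /= lerD2l lerN2; split=> [[]|]. Qed.

(** Maximal edges are those of rightmost subtiles: comparison with the subtile at the right end of
    [t] gives one direction, the left-to-right order of tiles the other. *)
Lemma max_edge_of n t s : (1 <= n)%N -> T n.+1 t -> sigma n.+1 t s ->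
  max_edge T sigma edge_le (edge_of n t s) <-> hi s = hi t.
Proof.
move=> n1 Tt ts; have [Ts h1 h2] := sigma_sub n1 Tt ts.
have eE := edge_of_in n1 Tt ts.
split=> [[_ H]|st].
  have [s' ts' s't] := sigma_hi n1 Tt; have [Ts' _ _] := sigma_sub n1 Tt ts'.
  have [ss'|/(tile_lt n1 Ts' Ts)] := leP (punct s) (punct s').
    have /(congr1 (@ulab _ _))/= /addrI/oppr_inj s's := H _ (edge_of_in n1 Tt ts')
      erefl ((edge_le_of n t s s').2 ss').
    by rewrite (punct_inj n1 Ts Ts').
  by have := punct_bounds_lt n1 Ts; lra.
split=> // e' e'E e't; have [s' ts' ->] := edge_at n1 Tt e'E e't.
have [Ts' _ h3] := sigma_sub n1 Tt ts'.
move=> /(edge_le_of n t s s').1; rewrite le_eqVlt => /orP[/eqP ss'|].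
  by rewrite (punct_inj n1 Ts Ts').
by move=> /(tile_lt n1 Ts Ts') h4;
  have := punct_bounds_lt n1 Ts' => h5; exfalso; lra.
Qed.

Lemma min_edge_of n t s : (1 <= n)%N -> T n.+1 t -> sigma n.+1 t s ->
  min_edge T sigma edge_le (edge_of n t s) <-> lo s = lo t.
Proof.
move=> n1 Tt ts; have [Ts h1 h2] := sigma_sub n1 Tt ts.
have eE := edge_of_in n1 Tt ts.
split=> [[_ H]|st].
  have [s' ts' s't] := sigma_lo n1 Tt; have [Ts' _ _] := sigma_sub n1 Tt ts'.
  have [ss'|/(tile_lt n1 Ts Ts')] := leP (punct s') (punct s).
    have /(congr1 (@ulab _ _))/= /addrI/oppr_inj s's := H _ (edge_of_in n1 Tt ts')
      erefl ((edge_le_of n t s' s).2 ss').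
    by rewrite (punct_inj n1 Ts Ts').
  by have := punct_bounds_lt n1 Ts; lra.
split=> // e' e'E e't; have [s' ts' ->] := edge_at n1 Tt e'E e't.
have [Ts' h3 _] := sigma_sub n1 Tt ts'.
move=> /(edge_le_of n t s' s).1; rewrite le_eqVlt => /orP[/eqP ss'|].
  by rewrite (punct_inj n1 Ts Ts').
by move=> /(tile_lt n1 Ts' Ts) h4;
  have := punct_bounds_lt n1 Ts' => h5; exfalso; lra.
Qed.

Lemma E1_max_min e : E T sigma 1 e ->
  max_edge T sigma edge_le e /\ min_edge T sigma edge_le e.
Proof.
move=> e1; have eE : edges T sigma e by exists 1%N.
suff H e' : edges T sigma e' -> rng e' = rng e -> e' = e.
  by split; split=> // e' e'E ee' _; exact: H.
move=> e'E ee'; apply: edge_eq => //.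
have [_ [t _ te]] := E_rng e1.
have [_ _ ->] : E T sigma 1 e' by exact: edges_rng e'E (etrans ee' te).
by case: e1.
Qed.

Lemma max_edge_ex n t : (1 <= n)%N -> T n t -> exists e,
  [/\ E T sigma n e, rng e = vtx n (cproto T n t) & max_edge T sigma edge_le e].
Proof.
case: n => [//|[_ Tt|n _ Tt]].
  have e1 : E T sigma 1 (Edge (root _ _) (vtx 1 (cproto T 1 t)) 0).
    by split => //; exists t.
  by eexists; split; [exact: e1| |case: (E1_max_min e1)].
have [s ts st] := sigma_hi (ltn0Sn n) Tt.
exists (edge_of n.+1 t s); split => //; first by apply/EP => //; exists t, s.
exact/max_edge_of.
Qed.

(** The subtile would fill the whole supertile and so coincide with the subtile that stays off the
    right end. *)
Lemma max_min_edge n e : (1 <= n)%N -> E T sigma n.+1 e ->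
  max_edge T sigma edge_le e -> min_edge T sigma edge_le e -> False.
Proof.
move=> n1 /(EP _ n1)[t [s [Tt ts ->]]] /(max_edge_of n1 Tt ts) hst.
move=> /(min_edge_of n1 Tt ts) lst; have [s' ts' s't] := sigma_inner n1 Tt.
have [Ts _ _] := sigma_sub n1 Tt ts; have [Ts' h1 _] := sigma_sub n1 Tt ts'.
have := punct_bounds_lt n1 Ts'; have := punct_bounds_lt n1 Ts => p1 p2.
have E : s = s' by apply: overlap_eq n1 Ts Ts' _ _; lra.
by move: s't; rewrite -E hst ltxx.
Qed.

Lemma max_edge_inj (e e' : edge R L) : max_edge T sigma edge_le e ->
  max_edge T sigma edge_le e' -> rng e = rng e' -> e = e'.
Proof.
move=> [eE He] [e'E He'] ee'.
have [_ /(_ e e' eE e'E)[_ /(_ ee')[le|le]]] := edge_leP.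
  by rewrite (He _ e'E).
by rewrite (He' _ eE).
Qed.

(** * Pairs of paths in one tiling *)

Local Notation bpath := (bpath T sigma).
Implicit Types x y z : bpath.

Lemma path_E x n : E T sigma n.+1 (eseq x n).
Proof. by case: (proj2_sig x n). Qed.

Lemma path_src x n : rng (eseq x n) = src (eseq x n.+1).
Proof. by case: (proj2_sig x n). Qed.

Lemma path_edge x n : edges T sigma (eseq x n).
Proof. by exists n.+1; exact: path_E. Qed.

Lemma bpath_eq x y : (forall n, eseq x n = eseq y n) -> x = y.
Proof.
case: x y => x px [y py] /= xy; have E : x = y by apply/funext.
by case: _ / E py => py; congr exist; exact: Prop_irrelevance.
Qed.

(* In the coordinate where the puncture of the tile of generation 1 of [x] is
   at 0, the tile of generation [n.+1] has its puncture at [pos x n.+1]. *)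
Definition pos x n : R := \sum_(i < n) ulab (eseq x i).

Lemma posS x n : pos x n.+1 = pos x n + ulab (eseq x n).
Proof. exact: big_ord_recr. Qed.

(** Since [eseq x n] has generation [n.+1], its source is the vertex of generation [n]. *)
Definition realizes x n t : Prop :=
  T n t /\ src (eseq x n) = vtx n (cproto T n t).

Lemma realizes_ex x n : (1 <= n)%N -> exists t, realizes x n t.
Proof.
case: n => // n _; have [_ [t Tt et]] := E_rng (path_E x n).
by exists t; split=> //; rewrite -path_src.
Qed.

Lemma realizes_cproto x n t s : realizes x n t -> realizes x n s ->
  cproto T n t = cproto T n s.
Proof. by move=> [_ xt] [_ xs]; exact: vtx_inj (etrans (esym xt) xs). Qed.

Lemma realizes_lo x n t s : (1 <= n)%N -> realizes x n t -> realizes x n s ->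
  lo t - punct t = lo s - punct s.
Proof.
move=> n1 xt xs; have [[Tt _] [Ts _]] := (xt, xs).
exact: cproto_lo n1 Tt Ts (realizes_cproto xt xs).
Qed.

Lemma realizes_hi x n t s : (1 <= n)%N -> realizes x n t -> realizes x n s ->
  hi t - punct t = hi s - punct s.
Proof.
move=> n1 xt xs; have [[Tt _] [Ts _]] := (xt, xs).
exact: cproto_hi n1 Tt Ts (realizes_cproto xt xs).
Qed.

Lemma realizes_down x n t : (1 <= n)%N -> realizes x n.+1 t -> exists s,
  [/\ realizes x n s, sigma n.+1 t s & eseq x n = edge_of n t s].
Proof.
move=> n1 [Tt xt]; have et := etrans (path_src x n) xt.
have [s ts es] := edge_at n1 Tt (path_edge x n) et.
have [Ts _ _] := sigma_sub n1 Tt ts.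
by exists s; split=> //; split=> //; rewrite es.
Qed.

(** Each label is the puncture of the supertile minus that of the subtile, so puncture minus [pos]
    is constant along the nested tiles. *)
Lemma descend x n m t : (1 <= n <= m)%N -> realizes x m t -> exists s,
  [/\ realizes x n s, lo t <= lo s, hi s <= hi t &
      punct s - pos x n = punct t - pos x m].
Proof.
case/andP=> n1; elim: m t => [|m IH] t.
  by rewrite leqn0 => /eqP n0; rewrite n0 in n1.
rewrite leq_eqVlt => /predU1P[-> xt|]; first by exists t.
rewrite ltnS => nm xt; have m1 := leq_trans n1 nm.
have [s [xs ts es]] := realizes_down m1 xt.
have [w [xw lw hw pw]] := IH s nm xs.
have [_ lt ht] := sigma_sub m1 (proj1 xt) ts.
exists w; split; [by []|lra|lra|].
by rewrite pw posS es /=; lra.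
Qed.

Lemma agree_at x y n t s : (1 <= n)%N -> realizes x n.+1 t ->
  realizes y n.+1 s -> t = s -> ulab (eseq x n) = ulab (eseq y n) ->
  eseq x n = eseq y n.
Proof.
move=> n1 [Tt xt] [Ts ys] ts uu; apply: edge_eq uu; try exact: path_edge.
by rewrite !path_src xt ys ts.
Qed.

(* In one tiling, the origin of the coordinates [pos y] lies at [c] in the
   coordinates [pos x]. *)
Definition coexist (c : R) x y : Prop := forall n, (1 <= n)%N -> exists t s,
  [/\ realizes x n t, realizes y n s &
      punct s - pos y n = punct t - pos x n + c].

Lemma coexist_frequently c x y :
  (forall n, exists2 m, (n <= m)%N & exists t s,
     [/\ realizes x m t, realizes y m s &
         punct s - pos y m = punct t - pos x m + c]) -> coexist c x y.
Proof.
move=> H n n1; have [m nm [t [s [xt ys ts]]]] := H n.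
have nm1 : (1 <= n <= m)%N by rewrite n1.
have [t' [xt' _ _ pt']] := descend nm1 xt.
have [s' [ys' _ _ ps']] := descend nm1 ys.
by exists t', s'; split => //; rewrite pt' ps'.
Qed.

Lemma coexist_sym c x y : coexist c x y -> coexist (- c) y x.
Proof.
move=> H n n1; have [t [s [xt ys ts]]] := H n n1.
by exists s, t; split => //; rewrite ts addrK.
Qed.

Lemma coexist_trans c d x y z : coexist c x y -> coexist d y z ->
  coexist (c + d) x z.
Proof.
move=> xy yz n n1; have [u [u' [yu zu' uu']]] := yz n n1.
(* The two hypotheses place [y] at possibly different spots of [T m]. This [m] makes the collar of
   the tile of [y] large enough to show the tile of [z] of generation [n] with its collar, which can
   then be moved from one spot to the other. *)
have [m nm rm] := rmin_large n (r n + `|hi u' - hi u| + `|lo u' - lo u|).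
have nm1 : (1 <= n <= m)%N by rewrite n1.
have m1 := leq_trans n1 nm.
have [t [s [xt ys ts]]] := xy m m1; have [s' [w [ys' zw sw]]] := yz m m1.
have [t1 [xt1 _ _ pt1]] := descend nm1 xt.
have [s1 [ys1 ls1 hs1 ps1]] := descend nm1 ys'.
have [w1 [zw1 lw1 hw1 pw1]] := descend nm1 zw.
have el := realizes_lo n1 ys1 yu; have eh := realizes_hi n1 ys1 yu.
have el' := realizes_lo n1 zw1 zu'; have eh' := realizes_hi n1 zw1 zu'.
have h1 := ler_norm (hi u' - hi u); have h2 := ler_norm (lo u - lo u').
have n1' := normr_ge0 (hi u' - hi u); have n2' := normr_ge0 (lo u' - lo u).
rewrite distrC in h2.
have [||Tw Ew] := near_cproto nm1 (proj1 ys') (proj1 ys)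
  (realizes_cproto ys' ys) (proj1 zw1).
- by lra.
- by lra.
exists t1, (tile_trans (punct s - punct s') w1); split=> //.
  by split=> //; rewrite Ew; case: zw1.
rewrite /=; lra.
Qed.

(** Commutativity of the diagrams says exactly that [ulab (h n) - pos y n + pos x n] does not depend
    on [n]; this number is [c]. *)
Lemma R_B_coexist x y : R_B x y <-> exists c, coexist c x y.
Proof.
split=> [[n0 [h [n01 H]]]|[c xy]].
  exists (ulab (h n0) - pos y n0 + pos x n0).
  apply: coexist_frequently => n; exists (maxn n0 n); first exact: leq_maxr.
  set m := maxn n0 n; have m0 : (n0 <= m)%N by exact: leq_maxl.
  have m1 := leq_trans n01 m0.
  have -> : ulab (h n0) - pos y n0 + pos x n0 = ulab (h m) - pos y m + pos x m.
    elim: m m0 {m1} => [|m IH]; first by rewrite leqn0 => /eqP ->.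
    rewrite leq_eqVlt => /predU1P[<-//|]; rewrite ltnS => m0.
    have [_ [_ _ _ _ u]] := H m m0; rewrite IH// !posS; lra.
  have [] := H m m0; rewrite /Defs.H; case: (m) m1 => // m' _.
  case=> t [s [[Tt Ts] _ et es u]] [e1 e2 _ _ _]; exists t, s.
  by split; [split=> //; rewrite -e1|split=> //; rewrite -e2|rewrite u; lra].
have [t [s [xt ys ts]]] := xy 1%N isT.
(* Later tiles contain the earlier ones, so their gap never exceeds that of [t] and [s]. Once [r n]
   bounds it, each tile lies in the collar of the other. *)
have [n0 n01 rn0] := rmin_large 1 (`|lo s - hi t| + `|lo t - hi s|).
exists n0, (fun n =>
  Edge (src (eseq x n)) (src (eseq y n)) (c + pos y n - pos x n)).
split=> // n n0n; have n1 := leq_trans n01 n0n.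
split; last by split=> //=; rewrite ?path_src// !posS; lra.
have [t1 [s1 [xt1 ys1 ts1]]] := xy n n1.
have nm : (1 <= 1 <= n)%N by [].
have [t2 [xt2 lt2 ht2 pt2]] := descend nm xt1.
have [s2 [ys2 ls2 hs2 ps2]] := descend nm ys1.
have el := realizes_lo (ltn0Sn _) xt2 xt;
have eh := realizes_hi (ltn0Sn _) xt2 xt.
have el' := realizes_lo (ltn0Sn _) ys2 ys;
have eh' := realizes_hi (ltn0Sn _) ys2 ys.
have h1 := ler_norm (lo s - hi t); have h2 := ler_norm (lo t - hi s).
have k1 := normr_ge0 (lo s - hi t); have k2 := normr_ge0 (lo t - hi s).
have rn : r n0 <= r n by apply: rmin_le; rewrite n01.
have [[Tt1 et1] [Ts1 es1]] := (xt1, ys1).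
suff : exists t s, [/\ T n t /\ T n s, Col T n s t /\ Col T n t s,
    src (eseq x n) = vtx n (cproto T n t), src (eseq y n) = vtx n (cproto T n s) &
    c + pos y n - pos x n = punct s - punct t] by case: (n) n1.
exists t1, s1; split=> //; last by lra.
by split; apply/ColP => //; split=> //; rewrite -/(r n); lra.
Qed.

(** With zero displacement the two tiles coincide; their supertiles then share a subtile and
    coincide too, so the displacement stays zero and the edges agree from there on. *)
Lemma coexist_eq0 c x y n : coexist c x y -> (1 <= n)%N ->
  c + pos y n - pos x n = 0 -> R_AF x y.
Proof.
move=> xy n1 c0; exists n.
have P m : (n <= m)%N -> c + pos y m - pos x m = 0.
  elim: m => [|m IH]; first by rewrite leqn0 => /eqP <-.
  rewrite leq_eqVlt => /predU1P[<-//|]; rewrite ltnS => nm.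
  have m1 := leq_trans n1 nm; have {IH nm}cm := IH nm.
  have [t [s [xt ys ts]]] := xy m.+1 isT.
  have [t' [xt' tt' et']] := realizes_down m1 xt.
  have [s' [ys' ss' es']] := realizes_down m1 ys.
  rewrite !posS et' es' /= in ts *.
  have E : t' = s' by apply: (punct_inj m1 (proj1 xt') (proj1 ys')); lra.
  have [_ l1 h1] := sigma_sub m1 (proj1 xt) tt'.
  have [_ l2 h2] := sigma_sub m1 (proj1 ys) ss'.
  have [p1 p2] := punct_bounds_lt m1 (proj1 ys').
  suff E2 : t = s by move: ts; rewrite E E2; lra.
  by apply: overlap_eq (ltn0Sn _) (proj1 xt) (proj1 ys) _ _; rewrite ?E in l1 h1; lra.
move=> m nm; have m1 := leq_trans n1 nm.
have [t [s [xt ys ts]]] := xy m.+1 isT.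
have p1 := P m nm; have := P m.+1 (leqW nm); rewrite !posS => p2.
apply: (agree_at m1 xt ys); last by lra.
by apply: (punct_inj (ltn0Sn _) (proj1 xt) (proj1 ys)); move: ts; rewrite !posS; lra.
Qed.

(* Once [2 r n] exceeds the gap between the tiles of [x] and [y], no tile fits
   in it, so that they are adjacent. *)
Lemma coexist_pos c x y : coexist c x y -> ~ R_AF x y ->
  0 < c + pos y 1 - pos x 1 ->
  exists N, forall n, (N <= n)%N -> max_edge T sigma edge_le (eseq x n) /\
                                    min_edge T sigma edge_le (eseq y n).
Proof.
move=> xy nAF c0; have [t0 [s0 [xt0 ys0 ts0]]] := xy 1%N isT.
have [N N1 rN] := rmin_large 1 (lo s0 - hi t0).
have adj n t s : (N <= n)%N -> realizes x n t -> realizes y n s ->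
    punct s - pos y n = punct t - pos x n + c -> hi t = lo s.
  move=> Nn xt ys ts; have n1 := leq_trans N1 Nn.
  have nm : (1 <= 1 <= n)%N by [].
  have [t1 [xt1 lt1 ht1 pt1]] := descend nm xt.
  have [s1 [ys1 ls1 hs1 ps1]] := descend nm ys.
  have el := realizes_lo (ltn0Sn _) ys1 ys0;
  have eh := realizes_hi (ltn0Sn _) xt1 xt0.
  have [[Tt _] [Ts _]] := (xt, ys).
  (* Positive displacement at generation 1 puts the tile of [x] left of that of [y], which fixes the
     order of the distinct tiles containing them. *)
  have ts1 : hi t1 <= lo s1.
    by apply: tile_lt (ltn0Sn _) (proj1 xt1) (proj1 ys1) _; lra.
  have bt1 := punct_bounds_lt (ltn0Sn _) (proj1 xt1).
  have bs1 := punct_bounds_lt (ltn0Sn _) (proj1 ys1).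
  have neq : t <> s.
    move=> E; apply: nAF; apply: coexist_eq0 xy n1 _.
    by move: ts; rewrite E; lra.
  have le : hi t <= lo s.
    have [h|] := leP (hi t) (lo s); first by [].
    move=> h; exfalso; apply: neq; apply: overlap_eq n1 Tt Ts _ _; last by lra.
    by lra.
  have [w Tw tw] := right_neighbour n1 Tt.
  have bw := punct_bounds n1 Tw; have r0 := rmin_gt0 n1.
  have rn : r N <= r n by apply: rmin_le; rewrite N1.
  have bs := punct_bounds n1 Ts.
  suff E : w = s by rewrite -tw E.
  by apply: overlap_eq n1 Tw Ts _ _; lra.
exists N => n Nn; have n1 := leq_trans N1 Nn.
have [t [s [xt ys ts]]] := xy n.+1 isT.
have [t' [xt' tt' et']] := realizes_down n1 xt.
have [s' [ys' ss' es']] := realizes_down n1 ys.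
(* Adjacency at both generations gives [hi t' <= hi t = lo s <= lo s' = hi t'], so all these ends
   coincide. *)
have a1 := adj n.+1 t s (leqW Nn) xt ys ts.
have a2 : hi t' = lo s'.
  by apply: adj Nn xt' ys' _; move: ts; rewrite !posS et' es' /=; lra.
have [_ l1 h1] := sigma_sub n1 (proj1 xt) tt'.
have [_ l2 h2] := sigma_sub n1 (proj1 ys) ss'.
rewrite et' es'; split.
  by apply/(max_edge_of n1 (proj1 xt) tt'); lra.
by apply/(min_edge_of n1 (proj1 ys) ss'); lra.
Qed.

(** * Eventually maximal and eventually minimal paths *)

Definition tail_max x : Prop :=
  exists N, forall n, (N <= n)%N -> max_edge T sigma edge_le (eseq x n).

Definition tail_min x : Prop :=
  exists N, forall n, (N <= n)%N -> min_edge T sigma edge_le (eseq x n).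

Lemma tail_max_min x : tail_max x -> tail_min x -> False.
Proof.
(* The successor ensures [1 <= n]: edges of generation 1, at index 0, are both maximal and
   minimal. *)
move=> [N HN] [M HM]; set n := (N + M).+1.
apply: (@max_min_edge n (eseq x n)) (path_E x n) (HN n _) (HM n _) => //.
  by rewrite /n -addnS leq_addr.
by rewrite /n -addSn leq_addl.
Qed.

(** The sign of the displacement at generation 1 decides; the negative case is the positive one with
    the paths exchanged. *)
Lemma R_B_cases x y : R_B x y ->
  [\/ R_AF x y, tail_max x /\ tail_min y | tail_min x /\ tail_max y].
Proof.
case/R_B_coexist => c xy; have [|nAF] := pselect (R_AF x y).
  exact: Or31.
have [d0|d0|d0] := ltgtP 0 (c + pos y 1 - pos x 1).
- have [N H] := coexist_pos xy nAF d0.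
  by apply: Or32; split; exists N => n /H[].
- have nAF' : ~ R_AF y x.
    by move=> [N H]; apply: nAF; exists N => n /H ->.
  have [|N H] := coexist_pos (coexist_sym xy) nAF'; first by lra.
  by apply: Or33; split; exists N => n /H[].
- by apply/Or31/(@coexist_eq0 c x y 1%N).
Qed.

Lemma R_B_sym x y : R_B x y -> R_B y x.
Proof.
by case/R_B_coexist => c xy; apply/R_B_coexist; exists (- c); exact: coexist_sym.
Qed.

Lemma R_B_trans x y z : R_B x y -> R_B y z -> R_B x z.
Proof.
case/R_B_coexist => c xy /R_B_coexist[d yz]; apply/R_B_coexist; exists (c + d).
exact: coexist_trans xy yz.
Qed.

Lemma R_AF_R_B x y : R_AF x y -> R_B x y.
Proof.
(* From [N] on the edges agree, so the difference of positions is constant and one tile serves both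
   paths. *)
move=> [N H]; apply/R_B_coexist; exists (pos x N - pos y N).
apply: coexist_frequently => n; exists (maxn N n).+1; first exact/leqW/leq_maxr.
set m := (maxn N n).+1; have Nm : (N <= m)%N by exact/leqW/leq_maxl.
have [t xt] := @realizes_ex x m isT.
exists t, t; split=> //; first by split; [case: xt|rewrite -H//; case: xt].
suff : pos x m - pos y m = pos x N - pos y N by lra.
elim: m Nm {xt} => [|m IH]; first by rewrite leqn0 => /eqP ->.
rewrite leq_eqVlt => /predU1P[<-//|]; rewrite ltnS => Nm.
by rewrite !posS H// -IH//; lra.
Qed.

(** * The successor of a maximal path *)

Lemma path_le_order (le : edge R L -> edge R L -> Prop) :
  partial_order_on (edges T sigma) le ->
  partial_order_on [set: bpath] (path_le le).
Proof.
move=> [_ le_anti le_trans]; split=> [x _|x y _ _|x y z _ _ _]; first by left.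
  move=> [//|[m [neq agr lem]]] [//|[m' [neq' agr' lem']]].
  have [mm'|mm'|mm'] := ltngtP m m'.
  - by have := agr _ mm' => /esym.
  - by have := agr' _ mm' => /esym.
  - by case: neq; apply: le_anti => //; [exact: path_edge..|rewrite mm'].
move=> [->//|[m [neq agr lem]]] [<-|[m' [neq' agr' lem']]].
  by right; exists m.
right; have [mm'|mm'|mm'] := ltngtP m m'.
- exists m'; rewrite (agr _ mm'); split=> // n m'n.
  by rewrite agr ?agr'// (ltn_trans mm').
- exists m; rewrite -(agr' _ mm'); split=> // n mn.
  by rewrite agr ?agr'// (ltn_trans mm').
- rewrite -mm' in neq' agr' lem'.
  exists m; split=> [xz|n mn|]; last by apply: le_trans lem lem'; exact: path_edge.
    (* If [x] and [z] agreed at [m], the edge of [y] there would lie both above and below that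
       common edge. *)
    by apply: neq; apply: le_anti => //; [exact: path_edge..|rewrite xz].
  by rewrite agr ?agr'.
Qed.

(** The tail is prolonged towards the root one generation at a time, by a maximal edge into the
    source of its first edge. *)
Lemma max_path_extend N (f : nat -> edge R L) :
  (forall n, (N <= n)%N -> [/\ E T sigma n.+1 (f n), rng (f n) = src (f n.+1) &
                              max_edge T sigma edge_le (f n)]) ->
  exists2 z : bpath, max_path edge_le z & forall n, (N <= n)%N -> eseq z n = f n.
Proof.
elim: N f => [|N IH] f H.
  have fp : is_path T sigma f by move=> n; have [] := H n isT.
  by exists (exist _ f fp) => // n; have [] := H n isT.
have [/(EP _ (ltn0Sn _))[t [s [Tt ts fN]]] _ _] := H N.+1 (leqnn _).
have [Ts _ _] := sigma_sub (ltn0Sn _) Tt ts.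
have [e [eE es emax]] := max_edge_ex (ltn0Sn _) Ts.
have [n Nn|z zmax zf] := IH (fun n => if n == N then e else f n).
  have [->|nN] := eqVneq n N.
    by rewrite gtn_eqF// fN.
  have NSn : (N < n)%N by rewrite ltn_neqAle eq_sym nN.
  by rewrite (gtn_eqF (leqW NSn)); exact: H.
by exists z => // n Nn; rewrite zf ?(ltnW Nn)// gtn_eqF.
Qed.

Lemma tail_max_extend x : tail_max x ->
  exists2 z, max_path edge_le z & R_AF x z.
Proof.
move=> [N H]; have [n Nn|z zmax zx] := @max_path_extend N (eseq x).
  by split; [exact: path_E|exact: path_src|exact: H].
by exists z => //; exists N => n /zx ->.
Qed.

(** Downward induction: equal edges have equal sources, and only one maximal edge enters a
    vertex. *)
Lemma max_path_R_AF x y : max_path edge_le x -> max_path edge_le y ->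
  R_AF x y -> x = y.
Proof.
move=> xm ym [N H]; apply: bpath_eq => n; move: n (leq0n n).
elim: N H => [//|N IH] H; apply: IH => n; rewrite leq_eqVlt => /predU1P[<-|];
  last exact: H.
by apply: max_edge_inj (xm N) (ym N) _; rewrite !path_src H.
Qed.

Lemma descend_max x n m t : max_path edge_le x -> (1 <= n <= m)%N ->
  realizes x m t -> exists s,
  [/\ realizes x n s, hi s = hi t & punct s - pos x n = punct t - pos x m].
Proof.
move=> xm /andP[n1]; elim: m t => [|m IH] t.
  by rewrite leqn0 => /eqP n0; rewrite n0 in n1.
rewrite leq_eqVlt => /predU1P[-> xt|]; first by exists t.
rewrite ltnS => nm xt; have m1 := leq_trans n1 nm.
have [s [xs ts es]] := realizes_down m1 xt.
have [w [xw hw pw]] := IH s nm xs; exists w; split; first by [].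
  by rewrite hw; apply/(max_edge_of m1 (proj1 xt) ts); rewrite -es; exact: xm.
by rewrite pw posS es /=; lra.
Qed.

(* Along a maximal path the right ends of all tiles coincide, so the collars of
   late generations show the whole collar of the right neighbour of
   generation [n]. *)
Lemma right_neighbour_cproto x n : max_path edge_le x -> (1 <= n)%N ->
  exists v M, forall m t s, (M <= m)%N -> realizes x m t -> T n s ->
    lo s = hi t -> cproto T n s = v.
Proof.
move=> xm n1; have [t0 xt0] := realizes_ex x n1.
have [s0 Ts0 ts0] := right_neighbour n1 (proj1 xt0).
have [M nM rM] := rmin_large n (r n + (hi s0 - lo s0)).
have nM1 : (1 <= n <= M)%N by rewrite n1.
have M1 := leq_trans n1 nM; have [t xt] := realizes_ex x M1.
have [t' [xt' ht' _]] := descend_max xm nM1 xt.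
have [s Ts ts] := right_neighbour n1 (proj1 xt').
have r0 := rmin_gt0 n1; have ls := lo_hi (tiling_tile n1 Ts).
have ls0 := lo_hi (tiling_tile n1 Ts0).
have lt := lo_hi (tiling_tile M1 (proj1 xt)).
(* [M] was chosen from the length of [s0], before [s] was known. The lengths agree because the
   collar at generation [n] already shows the right neighbour. *)
have lens : hi s - lo s = hi s0 - lo s0.
  have nn : (1 <= n <= n)%N by rewrite n1 leqnn.
  have bt' := punct_bounds_lt n1 (proj1 xt').
  have Ts' : T n (tile_trans (punct t0 - punct t') s).
    apply: near_tile_trans nn (proj1 xt') (proj1 xt0) 
      (realizes_cproto xt' xt0) Ts _ _;
    rewrite -/(r n); lra.
  have eh := realizes_hi n1 xt' xt0; have st := tiling_tile n1 Ts.
  rewrite -(lo_inj n1 Ts' Ts0) ?hi_trans ?lo_trans//; last by lra.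
  lra.
exists (cproto T n s), M => m t1 s1 Mm xt1 Ts1 ts1.
have Mm1 : (1 <= M <= m)%N by rewrite M1.
have [t2 [xt2 ht2 _]] := descend_max xm Mm1 xt1.
have eh := realizes_hi M1 xt xt2; have st := tiling_tile n1 Ts.
have [||Ts' <-] := near_cproto nM1 (proj1 xt) (proj1 xt2)
  (realizes_cproto xt xt2) Ts.
- rewrite -/(r n) -/(r M); lra.
- rewrite -/(r n) -/(r M); lra.
congr cproto; apply: lo_inj n1 Ts1 Ts' _; rewrite lo_trans//; lra.
Qed.

(** The vertices of the successor are the eventually constant collared prototiles [v n] of the right
    neighbours. These neighbours share their left end, so the edges joining them are minimal. *)
Lemma max_path_successor x : max_path edge_le x ->
  exists2 y, min_path edge_le y & R_B x y.
Proof.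
move=> xm.
have /choice[v vP] : forall n, exists v, (1 <= n)%N -> exists M, forall m t s,
    (M <= m)%N -> realizes x m t -> T n s -> lo s = hi t -> cproto T n s = v.
  case=> [|n]; last by have [v [M vM]] := right_neighbour_cproto xm (ltn0Sn n);
    exists v => _; exists M.
  by have [t [Tt _]] := realizes_ex x (ltn0Sn 0); exists (cproto T 0 t).
have vlo n s : (1 <= n)%N -> T n s -> cproto T n s = v n ->
    lo (v n).1 = lo s - punct s.
  by move=> n1 Ts <-; rewrite lo_trans//; exact: tiling_tile Ts.
(* [lo (v n).1] is the left end relative to the puncture; the label is the puncture difference of
   two tiles with a common left end. *)
pose f n : edge R L := if n is 0 then Edge (root _ _) (vtx 1 (v 1%N)) 0
  else Edge (vtx n (v n)) (vtx n.+1 (v n.+1)) (lo (v n).1 - lo (v n.+1).1).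
have fE n : (1 <= n)%N -> exists t s,
    [/\ T n.+1 t, sigma n.+1 t s, lo s = lo t & f n = edge_of n t s].
  move=> n1; have [M MP] := vP n n1; have [M' MP'] := vP n.+1 isT.
  (* This generation is late enough for the neighbours at both [n] and [n.+1] to have their final
     collared prototiles. *)
  set m := maxn n.+1 (maxn M M').
  have nm : (1 <= n.+1 <= m)%N by rewrite leq_maxl.
  have Mm : (M <= m)%N by rewrite !leq_max leqnn orbT.
  have Mm' : (M' <= m)%N by rewrite !leq_max leqnn !orbT.
  have [u xu] := realizes_ex x (leq_trans (ltn0Sn n) (proj2 (andP nm))).
  have [w [xw hw _]] := descend_max xm nm xu.
  have [t Tt wt] := right_neighbour (ltn0Sn n) (proj1 xw).
  have [s ts st] := sigma_lo n1 Tt; have [Ts _ _] := sigma_sub n1 Tt ts.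
  have tv : cproto T n.+1 t = v n.+1 by apply: MP' Mm' xu Tt _; rewrite wt.
  have sv : cproto T n s = v n by apply: MP Mm xu Ts _; rewrite st wt.
  exists t, s; split=> //.
  have -> : f n = Edge (vtx n (v n)) (vtx n.+1 (v n.+1))
    (lo (v n).1 - lo (v n.+1).1) by case: (n) n1.
  rewrite /edge_of tv sv; congr Edge.
  by rewrite (vlo n s)// (vlo n.+1 t)//; lra.
have fp : is_path T sigma f.
  move=> [|n]; split=> //; last first.
    by apply/EP => //; have [t [s [Tt ts _ ->]]] := fE n.+1 isT; exists t, s.
  have [t [s [Tt ts _ /(congr1 (@src _ _))/= vs]]] := fE 1%N isT.
  split=> //=; have [Ts _ _] := sigma_sub (ltn0Sn 0) Tt ts.
  by exists s.
exists (exist _ f fp).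
  move=> [|n]; first by have [] := E1_max_min (proj1 (fp 0%N)).
  have [t [s [Tt ts st]]] := fE n.+1 isT; rewrite /= => ->.
  exact/min_edge_of.
set y : bpath := exist _ f fp.
have posy n : pos y n.+1 = lo (v 1%N).1 - lo (v n.+1).1.
  elim: n => [|n IH]; first by rewrite /pos big_ord1/= subrr.
  by rewrite posS IH/=; lra.
have [u xu] := realizes_ex x (ltn0Sn 0).
(* The boundary point between the two paths lies at [hi u - punct u + pos x 1] in the coordinates of
   [x] and at [lo (v 1).1] in those of [y]; the constant is the difference. *)
apply/R_B_coexist; exists (hi u - punct u + pos x 1 - lo (v 1%N).1) => -[//|n] _.
have [M MP] := vP n.+1 isT; set m := maxn n.+1 M.
have nm : (1 <= n.+1 <= m)%N by rewrite leq_maxl.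
have [t xt] := realizes_ex x (leq_trans (ltn0Sn n) (proj2 (andP nm))).
have [t0 [xt0 ht0 pt0]] := descend_max xm nm xt.
have [s Ts ts] := right_neighbour (ltn0Sn n) (proj1 xt0).
have sv : cproto T n.+1 s = v n.+1.
  by apply: MP (leq_maxr _ _) xt Ts _; rewrite ts.
have n1 : (1 <= 1 <= n.+1)%N by [].
have [u' [xu' hu' pu']] := descend_max xm n1 xt0.
have eh := realizes_hi (ltn0Sn 0) xu xu'.
exists t0, s; split=> //; first by split=> //; rewrite sv.
by rewrite posy (vlo n.+1 s)//; lra.
Qed.

(** * Injectivity of the successor map and generation of [R_B] *)

Lemma exists_successor_map : exists psi : bpath -> bpath,
  [/\ set_fun (max_path edge_le) (min_path edge_le) psi,
      set_inj (max_path edge_le) psi &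
      forall x y : bpath, R_B x y <->
        clos_refl_sym_trans bpath
          (fun x' y' => R_AF x' y' \/ (max_path edge_le x' /\ y' = psi x')) x y].
Proof.
have /choice[psi psiP] : forall x, exists y,
    max_path edge_le x -> min_path edge_le y /\ R_B x y.
  move=> x; have [/max_path_successor[y]|nmax] := pselect (max_path edge_le x).
    by exists y.
  (* Off the maximal paths the requirement is void and any value will do. *)
  by exists x.
have tail x : max_path edge_le x -> tail_max x by move=> xm; exists 0%N.
have tailm x : min_path edge_le x -> tail_min x by move=> xm; exists 0%N.
exists psi; split.
- by move=> x /psiP[].
- move=> x x' /set_mem xm /set_mem xm' xx'.
  have [_ xy] := psiP x xm; have [_ xy'] := psiP x' xm'.
  (* Two maximal paths with the same image are [R_B]-related; the adjacent cases would make one of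
     them eventually minimal, so they are tail equivalent and hence equal. *)
  have : R_B x x' by apply: R_B_trans xy _; rewrite xx'; exact: R_B_sym.
  case/R_B_cases => [|[_]|[+ _]]; first exact: max_path_R_AF.
    by move/(tail_max_min (tail _ xm')).
  by move/(tail_max_min (tail _ xm)).
- move=> x y; set C := clos_refl_sym_trans _ _; split=> [xy|]; last first.
    elim=> {x y} [x y [|[xm ->]]|x|x y _|x y z _ + _].
    + exact: R_AF_R_B.
    + by have [] := psiP x xm.
    + by apply: R_AF_R_B; exists 0%N.
    + exact: R_B_sym.
    + exact: R_B_trans.
  have CAF (u w : bpath) : R_AF u w -> C u w by move=> uw; apply: rst_step; left.
  (* The chain is [u], a maximal path [z] with the same tail, [psi z], then [w]. The last two are
     related by [R_B] and both eventually minimal, which leaves only tail equivalence. *)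
  have CB (u w : bpath) : R_B u w -> tail_max u -> tail_min w -> C u w.
    move=> uw /tail_max_extend[z zm uz] wmin; have [ymin zy] := psiP z zm.
    apply: rst_trans (CAF _ _ uz) _; apply: rst_trans.
      by apply: rst_step; right.
    apply: CAF; have : R_B (psi z) w.
      exact: R_B_trans (R_B_trans (R_B_sym zy) (R_B_sym (R_AF_R_B uz))) uw.
    case/R_B_cases => [//|[/tail_max_min + _]|[_ /tail_max_min]].
      by move/(_ (tailm _ ymin)).
    by move/(_ wmin).
  case/R_B_cases: (xy) => [/CAF//|[xm ym]|[xm ym]]; first exact: CB.
  by apply: rst_sym; apply: CB => //; exact: R_B_sym.
Qed.

End NestedSequence.

Theorem proposition4p1 (R : realType) (L : Type)
    (T : nat -> set (tile R L)) (sigma : nat -> tile R L -> set (tile R L))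
    (HT : proper_nested_sequence T sigma) :
  exists le : edge R L -> edge R L -> Prop,
    [/\ edge_order T sigma le,
        partial_order_on [set: bpath T sigma] (path_le le) &
        exists psi : bpath T sigma -> bpath T sigma,
          [/\ set_fun (max_path le) (min_path le) psi,
              set_inj (max_path le) psi &
              forall x y : bpath T sigma,
                R_B x y <->
                clos_refl_sym_trans (bpath T sigma)
                  (fun x' y' => R_AF x' y' \/ (max_path le x' /\ y' = psi x'))
                  x y]].
Proof.
exists (@edge_le R L); have [leP le_total] := edge_leP HT; split.
- by split.
- exact: path_le_order.
- exact: exists_successor_map.
Qed.
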